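(* Let $D=(E,\mathcal{F})$ be a vf-safe delta-matroid. Then $$P(D;\lambda)=\sum_{A\subseteq E}(-1)^{|A|}\,\chi\big(D^{\pi(A)};\lambda\big),$$ where $D^{\pi(A)}:=(D+A)^*$, $P$ is the Penrose polynomial and $\chi$ is the characteristic polynomial of a delta-matroid.
   Context: A set system is a pair $D=(E,\mathcal{F})$ with $E$ a finite set and $\mathcal{F}$ a collection of subsets of $E$ (feasible sets). A delta-matroid is a set system with $\mathcal{F}\ne\emptyset$ such that for all $X,Y\in\mathcal{F}$ and $u\in X\bigtriangleup Y$ there is $v\in X\bigtriangleup Y$ (possibly $v=u$) with $X\bigtriangleup\{u,v\}\in\mathcal{F}$, where $\bigtriangleup$ is symmetric difference. A matroid is regarded as a delta-matroid whose feasible sets (its bases) all have the same cardinality. For $A\subseteq E$ the twist is $D*A=(E,\{A\bigtriangleup X:X\in\mathcal{F}\})$; the dual is $D^*=D*E$. For $e\in E$, $D+e=(E,\mathcal{F}\bigtriangleup\{F\cup\{e\}:F\in\mathcal{F},e\notin F\})$, and $D+\{e_1,\dots,e_n\}=D+e_1+\cdots+e_n$ (loop complementation; order immaterial). The dual pivot is $D\bar{*}A=((D*A)+A)*A$. Operations are applied from left to right. A delta-matroid is vf-safe if every sequence of twists and loop complementations applied to it results in a delta-matroid. The lower matroid $D_{\min}$ of a delta-matroid $D$ is the matroid on $E$ whose bases are the feasible sets of $D$ of minimum cardinality, and $d_D$ is its rank. Penrose polynomial of a vf-safe delta-matroid: $P(D;\lambda)=\sum_{X\subseteq E}(-1)^{|X|}\lambda^{d_{D*E\bar{*}X}}$.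 Characteristic polynomial of a matroid $M$ on $E$ with rank function $r$: $\chi(M;\lambda)=\sum_{A\subseteq E}(-1)^{|A|}\lambda^{r(M)-r(A)}$. For a delta-matroid $D$, $\chi(D;\lambda):=\chi(D_{\min};\lambda)$. *)

(* Defs.v *)
From mathcomp Require Import all_boot all_order all_algebra.

Set Implicit Arguments.
Unset Strict Implicit.
Unset Printing Implicit Defensive.

Import GRing.Theory.
Local Open Scope ring_scope.

Definition symdiff (T : finType) (A B : {set T}) : {set T} :=
  (A :\: B) :|: (B :\: A).

(* The ground set of a set system is the whole finite type E. *)
Definition set_system (E : finType) := {set {set E}}.

Definition delta_matroid (E : finType) (D : set_system E) : Prop :=
  D != set0 /\
  forall X Y : {set E}, X \in D -> Y \in D ->
  forall u : E, u \in symdiff X Y ->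
  exists2 v : E, v \in symdiff X Y & symdiff X [set u; v] \in D.

Definition twist (E : finType) (D : set_system E) (A : {set E}) :
  set_system E := [set symdiff A X | X in D].

Definition dual (E : finType) (D : set_system E) : set_system E :=
  twist D [set: E].

Definition loopc1 (E : finType) (D : set_system E) (e : E) : set_system E :=
  symdiff D [set F :|: [set e] | F in D & e \notin F].

(* The order of the single-element complementations is immaterial; see
   [loopc_perm] below. *)
Definition loopc (E : finType) (D : set_system E) (A : {set E}) :
  set_system E := foldl (@loopc1 E) D (enum A).

Definition dual_pivot (E : finType) (D : set_system E) (A : {set E}) :
  set_system E := twist (loopc (twist D A) A) A.

Inductive vf_op (E : finType) : Type :=
| Twist of {set E}
| LoopC of E.

Definition apply_vf_op (E : finType) (D : set_system E) (o : vf_op E) :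
  set_system E :=
  match o with
  | Twist A => twist D A
  | LoopC e => loopc1 D e
  end.

Definition vf_safe (E : finType) (D : set_system E) : Prop :=
  forall s : seq (vf_op E), delta_matroid (foldl (@apply_vf_op E) D s).

(* A matroid is given by its set of bases. *)
Definition indep (E : finType) (M : set_system E) (I : {set E}) : bool :=
  [exists B in M, I \subset B].

Definition rk (E : finType) (M : set_system E) (A : {set E}) : nat :=
  \max_(I : {set E} | (I \subset A) && indep M I) #|I|.

Definition lower_matroid (E : finType) (D : set_system E) : set_system E :=
  [set X in D | [forall Y in D, #|X| <= #|Y|]%N].

Definition lower_rank (E : finType) (D : set_system E) : nat :=
  rk (lower_matroid D) [set: E].

(* Polynomials in lambda are elements of {poly int}, with lambda = 'X.  The
   truncated subtraction is exact since [rk M] is monotone. *)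
Definition matroid_charpoly (E : finType) (M : set_system E) : {poly int} :=
  \sum_(A : {set E}) (-1) ^+ #|A| * 'X^(rk M [set: E] - rk M A).

Definition charpoly (E : finType) (D : set_system E) : {poly int} :=
  matroid_charpoly (lower_matroid D).

Definition penrose (E : finType) (D : set_system E) : {poly int} :=
  \sum_(X : {set E}) (-1) ^+ #|X| * 'X^(lower_rank (dual_pivot (dual D) X)).

Lemma in_symdiff (T : finType) (A B : {set T}) (x : T) :
  (x \in symdiff A B) = (x \in A) (+) (x \in B).
Proof. by rewrite !inE; case: (x \in A); case: (x \in B). Qed.

Lemma in_loopc1 (E : finType) (D : set_system E) (e : E) (X : {set E}) :
  (X \in loopc1 D e) = (X \in D) (+) ((e \in X) && (X :\ e \in D)).
Proof.
rewrite in_symdiff; congr (_ (+) _); apply/imsetP/andP.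
- case=> F; rewrite inE => /andP[FD eF] ->.
  by rewrite setUC setU1K // !inE eqxx.
- by case=> eX XD; exists (X :\ e); rewrite ?inE ?XD ?eqxx // setUC setD1K.
Qed.

Lemma loopc1C (E : finType) (D : set_system E) (e f : E) :
  loopc1 (loopc1 D e) f = loopc1 (loopc1 D f) e.
Proof.
have [->//|nef] := eqVneq e f.
apply/setP=> X; rewrite !in_loopc1 !inE nef (eq_sym f) nef /=.
have -> : X :\ f :\ e = X :\ e :\ f.
  by apply/setP=> x; rewrite !inE andbCA.
by case: (X \in D); case: (e \in X); case: (f \in X); case: (X :\ e \in D);
  case: (X :\ f \in D); case: (X :\ e :\ f \in D).
Qed.

Lemma loopc_perm (E : finType) (D : set_system E) (A : {set E}) (s : seq E) :
  perm_eq s (enum A) -> foldl (@loopc1 E) D s = loopc D A.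
Proof.
have loop_cons e t D' :
    foldl (@loopc1 E) (loopc1 D' e) t = loopc1 (foldl (@loopc1 E) D' t) e.
  by elim: t D' => //= f t IH D'; rewrite loopc1C IH.
rewrite /loopc => /permPl; move: s (enum A) => s t /permPl.
elim: s t D => [|e s IH] t D' st.
  by move: st; rewrite perm_sym => /perm_nilP->.
have et : e \in t by rewrite -(perm_mem st) mem_head.
case/splitPr: et st => t1 t2.
rewrite -[e :: t2]cat1s perm_sym perm_catCA perm_sym /= perm_cons => st.
by rewrite (IH _ _ st) !foldl_cat /= loop_cons.
Qed.

(* Main.v *)
Require Import Defs.
From mathcomp Require Import all_boot all_order all_algebra.

Import GRing.Theory.
Local Open Scope ring_scope.

(** Two observations carry the proof.

    The first turns the exponents of a characteristic polynomial into a minimum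
    over all feasible sets.  The exchange axiom lets a smallest feasible set be
    moved inside any given feasible set ([lower_matroid_below]), so the corank
    r(M) - r(B) in M = D_min, which is the least size of F \ B over the bases F
    of M, is also the least size of F \ B over all the feasible sets F of D
    ([corank_leE]).  Applied to the dual of a delta-matroid D', this says that
    the corank of B in the lower matroid of the dual is the least number of
    elements missed by F u B, for F feasible in D'.

    The second is that loop complementation at an element e of B leaves the
    family of the sets F u B unchanged: it only adds or removes feasible sets
    F u {e} for F already feasible, and it is an involution.  So, when e is in
    B, the exponent attached to (A, B) in the right-hand side is the same for A
    and for A u {e} ([corank_dual_loopcU1]), and these two terms have opposite
    signs.  All the terms with B nonempty cancel.

    What is left is the sum over A of (-1)^|A| X^d, with d the lower rank of
    (D+A)^*.  This is the Penrose polynomial: the twists in the dual pivot of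
    D^* by A cancel against the dual on A, so the result is (D+A)^*
    ([dual_pivot_dual]). *)

Section SetSystems.

Set Implicit Arguments.
Unset Strict Implicit.

Variable E : finType.
Implicit Types (D : set_system E) (A B F G X Y : {set E}) (e : E).

Lemma symdiffA A B X : symdiff A (symdiff B X) = symdiff (symdiff A B) X.
Proof. by apply/setP=> x; rewrite !in_symdiff addbA. Qed.

Lemma symdiffK A : involutive (symdiff A).
Proof. by move=> X; apply/setP=> x; rewrite !in_symdiff addKb. Qed.

Lemma in_twist D A X : (X \in twist D A) = (symdiff A X \in D).
Proof.
by rewrite -{1}(symdiffK A X) mem_imset //; apply: inv_inj (symdiffK A).
Qed.

Lemma in_dual D X : (X \in dual D) = (~: X \in D).
Proof.
by rewrite in_twist; congr (_ \in D); apply/setP=> x; rewrite in_symdiff !inE.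
Qed.

Lemma twist_twist D A B : twist (twist D A) B = twist D (symdiff A B).
Proof. by apply/setP=> X; rewrite !in_twist symdiffA. Qed.

Lemma loopc1K D e : loopc1 (loopc1 D e) e = D.
Proof.
apply/setP=> X; rewrite !in_loopc1 !inE eqxx /= addbF.
by case: (e \in X); case: (X \in D); case: (_ \in D).
Qed.

Lemma loopc1_twist D A e :
  e \notin A -> loopc1 (twist D A) e = twist (loopc1 D e) A.
Proof.
move=> eA; apply/setP=> X; rewrite in_loopc1 !in_twist in_loopc1.
rewrite in_symdiff (negPf eA) /=; congr (_ (+) (_ && (_ \in D))).
apply/setP=> x; rewrite !(in_symdiff, inE).
by case: eqVneq => [->|]; rewrite ?(negPf eA).
Qed.

Lemma loopc_twist D A B :
  [disjoint A & B] -> loopc (twist D A) B = twist (loopc D B) A.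
Proof.
move=> dAB; rewrite /loopc.
have : all (fun e => e \notin A) (enum B).
  by apply/allP=> e; rewrite mem_enum => /(disjointFl dAB)->.
by elim: (enum B) D => //= e s IH D' /andP[eA sA]; rewrite loopc1_twist ?IH.
Qed.

Lemma loopcU1 D A e :
  e \notin A -> loopc D (e |: A) = loopc1 (loopc D A) e.
Proof.
move=> eA; rewrite -(@loopc_perm _ D (e |: A) (rcons (enum A) e)).
  by rewrite -cats1 foldl_cat.
apply: uniq_perm; rewrite ?rcons_uniq ?mem_enum ?eA ?enum_uniq //.
by move=> x; rewrite mem_rcons in_cons !mem_enum !inE.
Qed.

Lemma dual_pivot_dual D A : dual_pivot (dual D) A = dual (loopc D A).
Proof.
rewrite /dual_pivot /dual twist_twist.
have -> : symdiff [set: E] A = ~: A.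
  by apply/setP=> x; rewrite in_symdiff !inE.
rewrite loopc_twist ?twist_twist; last by rewrite disjoints_subset.
by congr (twist _ _); apply/setP=> x; rewrite in_symdiff !inE addNb addbb.
Qed.

Lemma vf_safe_dual_loopc D A : vf_safe D -> delta_matroid (dual (loopc D A)).
Proof.
move=> /(_ (rcons [seq LoopC e | e <- enum A] (Twist [set: E]))).
rewrite -cats1 foldl_cat /= /dual /loopc.
by elim: (enum A) D => //= e s IH D'; apply: IH.
Qed.

Lemma lower_matroidP D F :
  reflect (F \in D /\ forall G, G \in D -> (#|F| <= #|G|)%N)
          (F \in lower_matroid D).
Proof.
rewrite /lower_matroid inE.
by apply: (iffP andP) => -[FD /forall_inP Fmin]; split=> //; apply/forall_inP.
Qed.

(** Every feasible set contains a basis of the lower matroid.  For a smallest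
    feasible F with the fewest elements outside G, an exchange from F towards G
    at an element of F \ G cannot shrink F, so it replaces that element by one
    of G, against the choice of F. *)
Lemma lower_matroid_below D G :
  delta_matroid D -> G \in D -> exists2 F, F \in lower_matroid D & F \subset G.
Proof.
move=> [_ exD] GD.
have [F0 F0L] : exists F, F \in lower_matroid D.
  case: (arg_minnP (fun X : {set E} => #|X|) GD) => F FD Fmin; exists F.
  by apply/lower_matroidP.
case: (arg_minnP (fun X : {set E} => #|X :\: G|) F0L) => F FL Fbest.
exists F => //; apply/subsetPn=> -[u uF uG].
have [FD Fmin] := lower_matroidP _ _ FL.
have uFG : u \in symdiff F G by rewrite in_symdiff uF (negPf uG).
have [v vFG F'D] := exD _ _ FD GD _ uFG.
(* If v is also in F, the exchange yields a proper subset of F. *)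
have := Fmin _ F'D; have [vF|vF] := boolP (v \in F).
  rewrite leqNgt proper_card //; apply/properP; split; last first.
    by exists u; rewrite // in_symdiff !inE uF eqxx.
  apply/subsetP=> x; rewrite in_symdiff !inE.
  by case: eqVneq => [->|_]; case: eqVneq => [->|_]; rewrite ?uF ?vF ?addbF.
have vG : v \in G by move: vFG; rewrite in_symdiff (negPf vF).
have F'E : symdiff F [set u; v] = v |: (F :\ u).
  apply/setP=> x; rewrite in_symdiff !inE.
  case: (eqVneq x v) => [->|_]; first by rewrite (negPf vF) orbT.
  by rewrite orbF; case: eqVneq => [->|_]; rewrite ?uF ?addbF.
have F'card : #|symdiff F [set u; v]| = #|F|.
  by rewrite F'E cardsU1 !inE (negPf vF) andbF (cardsD1 u F) uF.
have /Fbest : symdiff F [set u; v] \in lower_matroid D.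
  by apply/lower_matroidP; rewrite F'card.
rewrite /= leqNgt proper_card // F'E; apply/properP; split; last first.
  exists u; rewrite !inE ?uF ?uG // eqxx orbF andbC.
  by case: eqP uG => // ->; rewrite vG.
apply/subsetP=> x; rewrite !inE.
by case: (eqVneq x v) => [->|_]; rewrite ?vG //=; case/and3P=> -> _ ->.
Qed.

Lemma rk_geq_cardI D F B : F \in D -> (#|F :&: B| <= rk D B)%N.
Proof.
move=> FD; apply: (@leq_bigmax_cond _ _ (fun X => #|X|)).
by rewrite subsetIr; apply/exists_inP; exists F; rewrite ?subsetIl.
Qed.

Lemma rk_attained D B : D != set0 -> exists2 F, F \in D & rk D B = #|F :&: B|.
Proof.
case/set0Pn=> F0 F0D.
have i0 : (set0 \subset B) && indep D set0.
  by rewrite sub0set; apply/exists_inP; exists F0; rewrite ?sub0set.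
have [|I /andP[IB /exists_inP[F FD IF]] rkE] :=
  @eq_bigmax_cond _ (fun X => (X \subset B) && indep D X) (fun X => #|X|).
  by apply/card_gt0P; exists set0.
exists F => //; apply/eqP; rewrite eqn_leq rk_geq_cardI // andbT.
by rewrite [rk _ _]rkE subset_leq_card // subsetI IF.
Qed.

(** For a basis [F] of the lower matroid, [F \ B] has size r - |F n B|, so the
    corank of [B] is the least of these sizes.  Allowing all the feasible sets
    does not lower this minimum, since each of them contains a basis.  In this
    form the corank no longer refers to the lower matroid, which is hard to
    follow through a loop complementation of the dual. *)
Lemma corank_leE D B n : delta_matroid D ->
  (rk (lower_matroid D) [set: E] - rk (lower_matroid D) B <= n)%N
  = [exists F in D, (#|F :\: B| <= n)%N].
Proof.
move=> dmD; set L := lower_matroid D.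
have [G GD] : exists G, G \in D by apply/set0Pn; case: dmD.
have L0 : L != set0.
  by have [F FL _] := lower_matroid_below dmD GD; apply/set0Pn; exists F.
have sLD F : F \in L -> F \in D by case/lower_matroidP.
have rkT F : F \in L -> rk L [set: E] = #|F|.
  move=> FL; have [F' F'L ->] := rk_attained [set: E] L0.
  have [[FD Fmin] [F'D F'min]] :=
    (lower_matroidP _ _ FL, lower_matroidP _ _ F'L).
  by rewrite setIT; apply/eqP; rewrite eqn_leq F'min ?Fmin.
apply/idP/exists_inP=> [|[F FD Fn]].
  have [F FL ->] := rk_attained B L0.
  by rewrite (rkT F FL) -cardsD => ?; exists F; rewrite ?sLD.
have [F' F'L F'F] := lower_matroid_below dmD FD.
rewrite (rkT F' F'L); apply: leq_trans (leq_sub2l _ (rk_geq_cardI B F'L)) _.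
by rewrite -cardsD (leq_trans _ Fn) // subset_leq_card // setSD.
Qed.

Lemma corank_dual_leE D B n : delta_matroid (dual D) ->
  (rk (lower_matroid (dual D)) [set: E] - rk (lower_matroid (dual D)) B <= n)%N
  = [exists F in D, (#|~: (F :|: B)| <= n)%N].
Proof.
move=> dmD; rewrite corank_leE //; apply/exists_inP/exists_inP=> -[F FD Fn].
  by exists (~: F); rewrite -?in_dual // setCU setCK -setDE.
by exists (~: F); rewrite ?in_dual ?setCK // setDE -setCU.
Qed.

(** A set that becomes feasible is [e] added to a feasible one, and [B] absorbs
    [e].  Since loop complementation is an involution, this inclusion between
    the families of the sets [F :|: B] is an equality. *)
Lemma loopc1_setU D B e F : e \in B -> F \in loopc1 D e ->
  exists2 G, G \in D & G :|: B = F :|: B.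
Proof.
move=> eB; rewrite in_loopc1; have [FD _|_ /= /andP[_ FD]] := boolP (F \in D).
  by exists F.
exists (F :\ e) => //; apply/setP=> x; rewrite !inE.
by case: eqVneq => [->|]; rewrite ?eB ?orbT.
Qed.

Lemma corank_dual_loopcU1 D A B e : vf_safe D -> e \in B -> e \notin A ->
  let L A := lower_matroid (dual (loopc D A)) in
  (rk (L (e |: A)) [set: E] - rk (L (e |: A)) B
   = rk (L A) [set: E] - rk (L A) B)%N.
Proof.
move=> vfD eB eA L.
suff le_eq n : (rk (L (e |: A)) [set: E] - rk (L (e |: A)) B <= n)%N
             = (rk (L A) [set: E] - rk (L A) B <= n)%N.
  by apply/eqP; rewrite eqn_leq le_eq leqnn -le_eq leqnn.
rewrite !corank_dual_leE; try exact: vf_safe_dual_loopc.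
rewrite loopcU1 //; set D' := loopc D A.
apply/exists_inP/exists_inP=> -[F FD Fn].
  by have [G GD GE] := loopc1_setU eB FD; exists G; rewrite ?GE.
rewrite -(loopc1K D' e) in FD.
by have [G GD GE] := loopc1_setU eB FD; exists G; rewrite ?GE.
Qed.

Lemma rk_set0 D : rk D set0 = 0%N.
Proof.
apply/eqP; rewrite -leqn0; apply/bigmax_leqP=> I /andP[].
by rewrite subset0 => /eqP-> _; rewrite cards0.
Qed.

Lemma signed_sum_cancel (R : pzRingType) (f : {set E} -> R) e :
  (forall A, e \notin A -> f (e |: A) = f A) ->
  \sum_(A : {set E}) (-1) ^+ #|A| * f A = 0.
Proof.
move=> fE; rewrite (bigID (fun A : {set E} => e \in A)) /=.
rewrite (reindex_onto (setU [set e]) (fun A => A :\ e)) /=; last first.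
  by move=> A; apply: setD1K.
rewrite (eq_bigl (fun A : {set E} => e \notin A)) => [|A]; last first.
  rewrite !inE eqxx /=; apply/eqP/idP=> [<-|]; last exact: setU1K.
  by rewrite !inE eqxx.
rewrite -big_split big1 //= => A eA.
by rewrite fE // cardsU1 eA exprS mulN1r mulNr addNr.
Qed.

End SetSystems.

Theorem theorem5p4 (E : finType) (D : set_system E)
    (dmD : delta_matroid D) (vfD : vf_safe D) :
  penrose D =
    \sum_(A : {set E}) (-1) ^+ #|A| * charpoly (dual (loopc D A)).
Proof.
transitivity (\sum_(B : {set E}) (-1) ^+ #|B| * \sum_(A : {set E})
    (-1) ^+ #|A| * 'X^(rk (lower_matroid (dual (loopc D A))) [set: E]
                     - rk (lower_matroid (dual (loopc D A))) B) : {poly int}).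
  rewrite (bigD1 set0) //= [X in _ + X]big1 => [|B /set0Pn[e eB]].
    rewrite addr0 cards0 expr0 mul1r; apply: eq_bigr => A _.
    by rewrite dual_pivot_dual rk_set0 subn0.
  rewrite (@signed_sum_cancel _ _ _ e) ?mulr0 // => A eA.
  by rewrite corank_dual_loopcU1.
under eq_bigr => B _ do rewrite mulr_sumr.
rewrite exchange_big /=; apply: eq_bigr => A _; rewrite mulr_sumr.
by apply: eq_bigr => B _; rewrite mulrCA.
Qed.
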